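(* Let $a_1/b_1$ and $a_2/b_2$ be a Farey pair with $b_1>b_2$, and put $s=+1$ if $a_1/b_1<a_2/b_2$ and $s=-1$ otherwise. Let $i_{max}$ and $i$ be positive integers with $i<i_{max}$, let $N=b_1\,\mathrm{lcm}(1,2,\dots,i_{max})$, and let $q$ be an integer with $$\frac{N}{b_1(i+1)}<q\le\frac{N}{b_1i}.$$ Then $$I_N\left(\frac{a_1q+a_2}{b_1q+b_2}\right)=I_N\left(\frac{a_1}{b_1}\right)+s\,\frac{3}{\pi^2}\,q\left(\frac{N^2}{b_1^2q^2}-\left\{\frac{N}{b_1q}\right\}^2\right)+O(N\delta_A(i)).$$ In particular, for $a_1/b_1=0/1$ and $a_2/b_2=1/0$, $$I_N\left(\frac1q\right)=\frac{3}{\pi^2}\,q\left(\frac{N^2}{q^2}-\left\{\frac{N}{q}\right\}^2\right)+O(N\delta_A(i)),$$ and for $a_1/b_1=1/2$ and $a_2/b_2=1/1$, $$I_N\left(\frac{q+1}{2q+1}\right)=\frac{|F_N|}{2}+\frac{3}{\pi^2}\,q\left(\frac{N^2}{2^2q^2}-\left\{\frac{N}{2q}\right\}^2\right)+O(N\delta_A(i)).$$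
   Context: For a positive integer $N$, the Farey sequence $F_N$ is the ascending sequence of irreducible fractions in $[0,1]$ (including $0/1$ and $1/1$) whose denominators do not exceed $N$; $|F_N|$ is its number of elements. Fractions $a_1/b_1$, $a_2/b_2$ are written in lowest terms with nonnegative numerator and positive denominator (except for $1/0$ below). $I_N(x)$ is the position that $x$ occupies in $F_N$ (positions starting at $1$, so $I_N(0/1)=1$); equivalently $I_N(x)$ is the number of fractions of $F_N$ in $[0,x]$, and this is used as the definition for all $x\in[0,1]$. Two elements $a_1/b_1$ and $a_2/b_2$ of a Farey sequence form a Farey pair if $|a_1b_2-a_2b_1|=1$. Exceptionally, $0/1$ and $1/0$ are also allowed to form a Farey pair (with $a_1/b_1=0/1$, $a_2/b_2=1/0$, $1/0$ regarded as larger than $0/1$); this is the only case in which $b_2=0$. $\{x\}=x-\lfloor x\rfloor$ is the fractional part. For $A>0$, $$\delta_A(x)=\exp\left(-A\,\frac{(\log x)^{0.6}}{(\log\log x)^{0.2}}\right).$$ Here $A>0$ is a fixed constant for which the known estimate $E(x)=xH(x)+O(x\delta_A(x))$ holds, where, with $\varphi$ Euler's totient function, $E(x)=\sum_{k\le x}\varphi(k)-\frac{3}{\pi^2}x^2$ and $H(x)=\sum_{k\le x}\frac{\varphi(k)}{k}-\frac{6}{\pi^2}x$; such an $A$ is known to exist (Walfisz). The $O$-estimates are for $i\ge 3$ (so that $\delta_A(i)$ is defined), with implied constants absolute (for the fixed $A$). *)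

(* Defs.v *)
From HB Require Import structures.
From mathcomp Require Import all_boot all_order all_algebra.
From mathcomp Require Import all_classical all_reals all_analysis.

Set Implicit Arguments.
Unset Strict Implicit.
Unset Printing Implicit Defensive.

Import Order.TTheory GRing.Theory Num.Theory.

Local Open Scope ring_scope.

Definition farey (N : nat) : seq rat :=
  sort <=%O [seq (a%:R / b%:R : rat) | b <- iota 1 N,
                                       a <- [seq a <- iota 0 b.+1 | coprime a b]].

Lemma mem_farey (N : nat) (x : rat) :
  (x \in farey N) = (0 <= x <= 1) && (denq x <= N%:Z).
Proof.
rewrite mem_sort; apply/allpairsPdep/idP => [[b [a []]]|].
  rewrite mem_iota mem_filter mem_iota => /andP[b0 bN] /and3P[cab _ ab] ->.
  have b0' : (0 : rat) < b%:R by rewrite ltr0n.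
  rewrite divr_ge0 ?ler0n //= ler_pdivrMr// mul1r ler_nat.
  rewrite !pmulrn coprimeq_den//.
  have -> : (b%:Z == 0) = false by case: b b0 {bN cab ab b0'}.
  by rewrite lez_nat; apply/andP; split; rewrite -ltnS.
move=> /andP[/andP[x0 x1] dN].
have [n En] : exists n : nat, numq x = n%:Z.
  by exists `|numq x|%N; rewrite gez0_abs// numq_ge0.
have [d Ed] : exists d : nat, denq x = d%:Z.
  by exists `|denq x|%N; rewrite gez0_abs.
have d0 : (0 < d)%N by rewrite -ltz_nat -Ed.
exists d, n; split.
- by rewrite mem_iota d0 /= add1n ltnS -lez_nat -Ed.
- rewrite mem_filter mem_iota /= add0n ltnS.
  have := coprime_num_den x; rewrite En Ed /= => ->/=.
  move: x1; rewrite -(divq_num_den x) En Ed ler_pdivrMr ?ltr0z//.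
  by rewrite mul1r ler_int.
- by rewrite !pmulrn -Ed -En divq_num_den.
Qed.

Lemma farey_uniq (N : nat) : uniq (farey N).
Proof.
rewrite sort_uniq; apply: allpairs_uniq_dep; first exact: iota_uniq.
  by move=> b _; rewrite filter_uniq// iota_uniq.
have P (u : {_ : nat & nat}) :
    u \in [seq existT (fun=> nat) b a | b <- iota 1 N,
      a <- [seq a <- iota 0 b.+1 | coprime a b]] ->
    numq ((tagged u)%:R / (tag u)%:R) = (tagged u)%:Z
    /\ denq ((tagged u)%:R / (tag u)%:R) = (tag u)%:Z.
  move=> /allpairsPdep[b [a [+ + ->]]]/=.
  rewrite mem_iota mem_filter => /andP[b0 _] /andP[cab _].
  have b0' : (0 < b%:Z) by rewrite ltz_nat.
  rewrite !pmulrn (coprimeq_num (cab : coprime `|a%:Z| `|b%:Z|)).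
  rewrite (coprimeq_den (cab : coprime `|a%:Z| `|b%:Z|)).
  by rewrite gtr0_sg// mul1r gt_eqF.
move=> [b a] [b' a'] /P[/= n1 d1] /P[/= n2 d2] e.
by move: n1 d1; rewrite e n2 d2 => -[->] [->].
Qed.

Lemma farey_ascending (N : nat) : sorted <%O (farey N).
Proof. by rewrite lt_sorted_uniq_le farey_uniq sort_le_sorted. Qed.

(* Defined for every real x; positions in the sequence start at 1, so at
   x = ratr y with y \in farey N this is (index y (farey N)).+1. *)
Definition farey_pos (R : realType) (N : nat) (x : R) : nat :=
  count (fun y : rat => ratr y <= x) (farey N).

Definition farey_fraction (a b : nat) : bool :=
  [&& (0 < b)%N, (a <= b)%N & coprime a b].

(* The second disjunct is the exceptional pair 0/1, 1/0. *)
Definition farey_pair (a1 b1 a2 b2 : nat) : Prop :=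
  [/\ farey_fraction a1 b1, farey_fraction a2 b2
    & `|a1%:Z * b2%:Z - a2%:Z * b1%:Z| = 1]
  \/ [/\ a1 = 0, b1 = 1, a2 = 1 & b2 = 0]%N.

(* The first test makes 1/0 larger than every fraction (in rat, 1/0 = 0). *)
Definition farey_sign (R : realType) (a1 b1 a2 b2 : nat) : R :=
  if (b2 == 0)%N || (a1%:R / b1%:R < a2%:R / b2%:R :> rat) then 1 else -1.

Definition lcm_upto (n : nat) : nat := \big[lcmn/1]_(1 <= k < n.+1) k.

Definition frac_part (R : realType) (x : R) : R := x - (Num.floor x)%:~R.

Definition delta (R : realType) (A x : R) : R :=
  expR (- (A * (ln x `^ (6 / 10) / ln (ln x) `^ (2 / 10)))).

Definition totient_err (R : realType) (x : R) : R :=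
  \sum_(1 <= k < (Num.truncn x).+1) (totient k)%:R - 3 / pi ^+ 2 * x ^+ 2.

Definition totient_ratio_err (R : realType) (x : R) : R :=
  \sum_(1 <= k < (Num.truncn x).+1) (totient k)%:R / k%:R - 6 / pi ^+ 2 * x.

(* E(x) = x H(x) + O(x delta_A(x)); since ln (ln x) > 0 for x >= 3, the
   function delta A is meaningful on the whole range. *)
Definition walfisz_estimate (R : realType) (A : R) : Prop :=
  exists C : R, forall x : R, 3 <= x ->
    `|totient_err x - x * totient_ratio_err x| <= C * (x * delta A x).

(* Main.v *)
Require Import Defs.
From HB Require Import structures.
From mathcomp Require Import all_boot all_order all_algebra.
From mathcomp Require Import all_classical all_reals all_analysis.
From mathcomp Require Import zify ring lra.

(* Let e = a2 b1 - a1 b2 = +1 or -1.  The reduced fractions between a1/b1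
   (excluded) and (a1 q + a2)/(b1 q + b2) (included) are the mediants
   (m a1 + n a2)/(m b1 + n b2) with m, n coprime, n >= 1 and m >= n q.  Put
   L = lcm(1, ..., imax), so N = b1 L.  The bound m b1 + n b2 <= b1 L forces
   n <= i, and since n divides L and b2 < b1 it leaves (L/n - q) phi(n) + O(n)
   values of m.  The sum over n <= i is L S(i) - q Phi(i) + O(i^2), where
   S(x) = sum_(k <= x) phi(k)/k and Phi(x) = sum_(k <= x) phi(k).  Since i is
   the integer part of L/q, this differs from the claimed main term by
   (L - q i) H(i) - q (E(i) - i H(i)).

   The second summand is O(L delta(i)) by hypothesis.  For the first one it
   suffices that H(i) = O(sqrt i), since delta decays more slowly than any
   power.  This needs no value of zeta(2): E(n) - n H(n) equals
   3/pi^2 n^2 - sum_(k < n) S(k), so the hypothesis says that the sums of the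
   nondecreasing sequence S are quadratic up to O(n).  Finally
   i^3 <= 4 L makes O(i^2) negligible. *)

Set Implicit Arguments.
Unset Strict Implicit.
Unset Printing Implicit Defensive.

Import Order.TTheory GRing.Theory Num.Theory.

Local Open Scope ring_scope.

(** * Coprime lattice points *)

Lemma dvdn_lcm_upto (n k : nat) : (0 < k <= n)%N -> (k %| lcm_upto n)%N.
Proof.
move=> /andP[k0 kn]; rewrite /lcm_upto (bigD1_seq k) ?iota_uniq//=.
  exact: dvdn_lcml.
by rewrite mem_index_iota k0 ltnS.
Qed.

Lemma lcm_upto_gt0 (n : nat) : (0 < lcm_upto n)%N.
Proof.
rewrite /lcm_upto big_seq; elim/big_ind: _ => // [x y x0 y0|k].
  by rewrite lcmn_gt0 x0.
by rewrite mem_index_iota => /andP[].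
Qed.

(* [(i + 1) (i (i - 1))] divides [2 lcm_upto n]. *)
Lemma cube_le_lcm_upto (i n : nat) :
  (1 < i < n)%N -> (i ^ 3 <= 4 * lcm_upto n)%N.
Proof.
move=> /andP[i1 ilt].
have cop : coprime i i.-1 by rewrite coprimenP//; lia.
have d1 : (i * i.-1 %| lcm_upto n)%N.
  by rewrite Gauss_dvd// !dvdn_lcm_upto//; lia.
have d2 : (i.+1 %| lcm_upto n)%N by rewrite dvdn_lcm_upto//; lia.
have d3 : (lcmn i.+1 (i * i.-1) %| lcm_upto n)%N by rewrite dvdn_lcm d1 d2.
have le1 := dvdn_leq (lcm_upto_gt0 n) d3.
(* The gcd divides [i (i - 1) - (i + 1) (i - 2) = 2]. *)
have g2 : (gcdn i.+1 (i * i.-1) <= 2)%N.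
  apply: dvdn_leq => //.
  have -> : 2%N = (i * i.-1 - i.+1 * i.-2)%N by nia.
  by rewrite dvdn_sub ?dvdn_gcdr// dvdn_mulr// dvdn_gcdl.
have := muln_lcm_gcd i.+1 (i * i.-1).
move: (lcmn _ _) (gcdn _ _) le1 g2 => l g le1 g2 e.
have {e g2} : (i.+1 * (i * i.-1) <= l * 2)%N by rewrite -e leq_mul2l g2 orbT.
have [j ->] : exists j, i = j.+2 by exists i.-2; lia.
nia.
Qed.

(** Coprimality to [n] depends only on the residue modulo [n], so each block contributes
    [totient n]. *)
Lemma count_coprime_blocks (n j k : nat) : (j <= k)%N ->
  count (coprime n) (index_iota (j * n) (k * n)) = ((k - j) * totient n)%N.
Proof.
rewrite -sum1_count big_mkcond/=.
elim: k => [|k IH]; first by rewrite leqn0 => /eqP ->; rewrite big_nil.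
rewrite leq_eqVlt => /predU1P[->|]; first by rewrite subnn big_geq.
rewrite ltnS => jk; rewrite (@big_cat_nat _ _ _ (k * n)) ?leq_mul2r ?jk ?leqnSn ?orbT//=.
rewrite IH// subSn// [RHS]mulSnr; congr (_ + _)%N.
rewrite totient_count_coprime mulSnr addnC -{1}[(k * n)%N]add0n big_addn addnK.
apply: eq_bigr => m _; rewrite -coprime_modr addnC modnMDl coprime_modr.
by case: coprime.
Qed.

Lemma index_iota_cat (a b c : nat) : (a <= b)%N -> (b <= c)%N ->
  index_iota a c = index_iota a b ++ index_iota b c.
Proof.
move=> ab bc; rewrite /index_iota.
have -> : (c - a = (b - a) + (c - b))%N by lia.
by rewrite iotaD subnKC.
Qed.

(* Numbers coprime to [n] are equidistributed over blocks of length [n]; only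
   the last block before [k * n] can be affected by the second constraint. *)
Lemma count_coprime_slanted (n j k b1 b2 : nat) :
  (0 < n)%N -> (j <= k)%N -> (b2 < b1)%N ->
  let c := count (fun m => coprime n m && (m * b1 + n * b2 <= b1 * (k * n))%N)
             (index_iota (j * n) (k * n).+1) in
  (c <= (k - j) * totient n + n)%N /\ ((k - j) * totient n <= c + n)%N.
Proof.
move=> n0 jk b21 /=.
have jkn : (j * n <= k * n)%N by rewrite leq_mul2r jk orbT.
rewrite (@index_iota_cat _ (k * n))// count_cat.
have -> : index_iota (k * n) (k * n).+1 = [:: (k * n)%N].
  by rewrite /index_iota subSnn.
(* Upper bound: the second constraint is dropped, and the extra endpoint [k * n] costs at most
   [1 <= n]. *)
rewrite /= addn0; split.
  rewrite -(count_coprime_blocks n jk); apply: leq_add.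
    by apply: sub_count => m /andP[].
  by case: (_ && _).
have tn : (totient n <= n)%N.
  rewrite totient_count_coprime; apply: (@leq_trans (\sum_(0 <= d < n) 1)%N).
    by apply: leq_sum => d _; case: coprime.
  by rewrite sum_nat_const_nat subn0 muln1.
move: jk; rewrite leq_eqVlt => /predU1P[->|jk]; first by rewrite subnn.
have [k' ke] : exists k', k = k'.+1 by exists k.-1; lia.
have jk' : (j <= k')%N by lia.
(* Lower bound: the last block is given up at a cost of [totient n <= n]. Before it [m < k' * n],
   and [b2 < b1] makes the second constraint automatic. *)
rewrite ke subSn// mulSn addnC; apply: leq_add => //.
rewrite -(count_coprime_blocks n jk').
have a1 : (j * n <= k' * n)%N by rewrite leq_mul2r jk' orbT.
have a2 : (k' * n <= k'.+1 * n)%N by rewrite leq_mul2r leqnSn orbT.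
rewrite (index_iota_cat a1 a2) count_cat -addnA; apply: leq_trans (leq_addr _ _).
apply: eq_leq; apply: eq_in_count => m; rewrite mem_index_iota => /andP[_ mk].
case: coprime => //=; symmetry.
have : (m * b1 + n * b2 <= (k' * n) * b1 + n * b1)%N.
  by apply: leq_add; rewrite leq_mul2r || rewrite leq_mul2l; lia.
lia.
Qed.

(** * Farey fractions between mediants *)

Section Mediants.

Variables (a1 b1 a2 b2 : nat) (e : int).
Hypotheses (eE : e = a2%:Z * b1%:Z - a1%:Z * b2%:Z) (e2 : e * e = 1).

(** Cramer's rule; [e] is its own inverse, so the coordinates are integral. *)
Lemma mediant_coordE (m n : nat) :
  let A := (m * a1 + n * a2)%N%:Z in
  let B := (m * b1 + n * b2)%N%:Z in
  n%:Z = e * (A * b1%:Z - a1%:Z * B) /\ m%:Z = e * (a2%:Z * B - A * b2%:Z).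
Proof.
by rewrite /= !PoszD !PoszM; split; rewrite -[LHS]mul1r -e2 -mulrA {2}eE; ring.
Qed.

Lemma coord_mediantE (A B : int) :
  let n := e * (A * b1%:Z - a1%:Z * B) in
  let m := e * (a2%:Z * B - A * b2%:Z) in
  A = m * a1%:Z + n * a2%:Z /\ B = m * b1%:Z + n * b2%:Z.
Proof.
by split; rewrite -[LHS]mul1r -e2 -mulrA {2}eE; ring.
Qed.

(** The change of coordinates is unimodular: a common divisor of numerator and denominator divides
    both coordinates. *)
Lemma coprime_mediant (m n : nat) : coprime n m ->
  coprime (m * a1 + n * a2) (m * b1 + n * b2).
Proof.
move=> cop; set A := (m * a1 + _)%N; set B := (m * b1 + _)%N.
have [] := mediant_coordE m n; rewrite -/A -/B => nE mE.
set d := gcdn A B.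
rewrite /coprime -/d -dvdn1 -(eqP cop) dvdn_gcd.
have dA : (d %| A%:Z)%Z by rewrite dvdzE dvdn_gcdl.
have dB : (d %| B%:Z)%Z by rewrite dvdzE dvdn_gcdr.
have dn : (d %| n%:Z)%Z.
  by rewrite nE; apply/dvdz_mull/rpredB; [exact: dvdz_mulr|exact: dvdz_mull].
have dm : (d %| m%:Z)%Z.
  by rewrite mE; apply/dvdz_mull/rpredB; [exact: dvdz_mull|exact: dvdz_mulr].
by move: dn dm; rewrite !dvdzE => -> ->.
Qed.

Lemma mediant_frac (m n : nat) : (0 < m * b1 + n * b2)%N -> coprime n m ->
  let y : rat := (m * a1 + n * a2)%:R / (m * b1 + n * b2)%:R in
  numq y = (m * a1 + n * a2)%N%:Z /\ denq y = (m * b1 + n * b2)%N%:Z.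
Proof.
move=> B0 /coprime_mediant; move: (_ + _)%N (_ + _)%N B0 => A B B0 cAB /=.
have B0' : (0 < B%:Z) by rewrite ltz_nat.
rewrite !pmulrn (coprimeq_num (cAB : coprime `|A%:Z| `|B%:Z|)).
rewrite (coprimeq_den (cAB : coprime `|A%:Z| `|B%:Z|)).
by rewrite gtr0_sg// mul1r gt_eqF.
Qed.

Lemma frac_coords (x : rat) :
  0 <= e * (a2%:Z * denq x - numq x * b2%:Z) ->
  0 <= e * (numq x * b1%:Z - a1%:Z * denq x) ->
  exists m n : nat, [/\ coprime n m, x = (m * a1 + n * a2)%:R / (m * b1 + n * b2)%:R
    & denq x = (m * b1 + n * b2)%N%:Z].
Proof.
have := coord_mediantE (numq x) (denq x).
(* The sign hypotheses exclude the negative integers, so both coordinates are naturals. *)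
case: (_ * (_ - _)) => // n; case: (_ * (_ - _)) => // m /= [] + + _ _.
rewrite -!PoszM -!PoszD => xn xd; exists m, n; split=> //; last first.
  by rewrite -[LHS]divq_num_den xn xd.
have := coprime_num_den x; rewrite xn xd /= => cop.
rewrite /coprime -dvdn1 -(eqP cop) dvdn_gcd !dvdn_add// dvdn_mulr//;
  by rewrite ?dvdn_gcdl ?dvdn_gcdr.
Qed.

(* The reduced fractions from [a1/b1] (excluded) to
   [(a1 q + a2)/(b1 q + b2)] (included) are the [(m a1 + n a2)/(m b1 + n b2)]
   with [m], [n] coprime, [n > 0] and [m >= n q]; the sign [e] covers both
   orders of the pair. *)
Lemma count_farey_mediants (q L i : nat) :
  (0 < b1)%N -> (0 < q)%N -> (a1 <= b1)%N ->
  (a1 * q + a2 <= b1 * q + b2)%N -> (L < i.+1 * q)%N ->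
  count (fun x : rat =>
      (0 < e * (numq x * b1%:Z - a1%:Z * denq x)) &&
      (0 <= e * (denq x * (a1 * q + a2)%N%:Z - numq x * (b1 * q + b2)%N%:Z)))
    (farey (b1 * L))
  = \sum_(1 <= n < i.+1)
      count (fun m => coprime n m && (m * b1 + n * b2 <= b1 * L)%N)
        (index_iota (q * n) L.+1).
Proof.
move=> b10 q0 ab1 abq Lq.
pose T n := [seq m <- index_iota (q * n) L.+1 |
               coprime n m && (m * b1 + n * b2 <= b1 * L)%N].
pose f n m : rat := (m * a1 + n * a2)%:R / (m * b1 + n * b2)%:R.
have memT n m : m \in T n -> (0 < n)%N ->
    [/\ coprime n m, (m * b1 + n * b2 <= b1 * L)%N, (q * n <= m)%N
      & (0 < m * b1 + n * b2)%N].
  rewrite mem_filter mem_index_iota => /andP[/andP[c h] /andP[h2 _]] n0.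
  by split => //; rewrite addn_gt0 muln_gt0 b10 (leq_trans _ h2)// muln_gt0 q0.
transitivity (size [seq f n m | n <- iota 1 i, m <- T n]); last first.
  rewrite size_allpairs_dep sumnE big_map /index_iota subn1/=.
  by apply: eq_bigr => n _; rewrite size_filter.
rewrite -size_filter; apply/perm_size/uniq_perm.
- by rewrite filter_uniq// farey_uniq.
- apply: allpairs_uniq_dep; first exact: iota_uniq.
    by move=> n _; rewrite filter_uniq// iota_uniq.
  (* Injectivity: [n] and [m] are recovered from the reduced numerator and denominator. *)
  have P (u : {_ : nat & nat}) :
      u \in [seq existT (fun=> nat) n m | n <- iota 1 i, m <- T n] ->
      (tag u)%:Z = e * (numq (f (tag u) (tagged u)) * b1%:Z
                        - a1%:Z * denq (f (tag u) (tagged u))) /\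
      (tagged u)%:Z = e * (a2%:Z * denq (f (tag u) (tagged u))
                        - numq (f (tag u) (tagged u)) * b2%:Z).
    move=> /allpairsPdep[n [m [+ + ->]]]/=.
    rewrite mem_iota => /andP[n0 _] /memT/(_ n0)[cop _ _ B0].
    have [-> ->] := mediant_frac B0 cop.
    exact: mediant_coordE.
  move=> [n m] [n' m'] /P[/= E1 E2] /P[/= E3 E4] fe.
  by move: E1 E2; rewrite fe -E3 -E4 => -[->] [->].
move=> x; rewrite mem_filter mem_farey; apply/idP/allpairsPdep.
  move=> /andP[/andP[x1 x2] /andP[/andP[x3 x4] xN]].
  (* The condition at the closed endpoint reads [m - n q >= 0] in coordinates. *)
  have mnq : 0 <= e * (a2%:Z * denq x - numq x * b2%:Z)
                  - e * (numq x * b1%:Z - a1%:Z * denq x) * q%:Z.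
    by move: x2; rewrite !PoszD !PoszM; congr (0 <= _); ring.
  have m0 : 0 <= e * (a2%:Z * denq x - numq x * b2%:Z).
    apply: le_trans mnq _; rewrite gerBl mulr_ge0//; exact: ltW.
  have [m [n [cop xE dE]]] := frac_coords m0 (ltW x1).
  have B0 : (0 < m * b1 + n * b2)%N by rewrite -ltz_nat -dE.
  have [nE mE] := mediant_coordE m n.
  have [+ _] := mediant_frac B0 cop; rewrite -xE => numE.
  move: nE mE; rewrite -numE -dE => nE mE.
  move: x1 mnq; rewrite -nE -mE subr_ge0 -PoszM lez_nat => n0 nqm.
  have BN : (m * b1 + n * b2 <= b1 * L)%N by rewrite -lez_nat -dE.
  have mL : (m <= L)%N.
    by rewrite -(leq_pmul2l b10) mulnC (leq_trans (leq_addr _ _) BN).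
  exists n, m; split => //.
    rewrite mem_iota; apply/andP; split; first by rewrite -ltz_nat.
    (* Here [n q <= m <= L < (i + 1) q]. *)
    by rewrite add1n -(ltn_pmul2r q0); lia.
  by rewrite mem_filter cop BN mem_index_iota mulnC nqm ltnS mL.
move=> [n [m [+ + ->]]]; rewrite mem_iota => /andP[n0 _] /memT/(_ n0)[cop BN qm B0].
have [nE dE] := mediant_frac B0 cop.
rewrite -/(f n m) in nE dE *; rewrite dE lez_nat BN andbT.
have [E1 E2] := mediant_coordE m n.
rewrite nE -[X in (0 < X)]E1 ltz_nat n0 /=.
have -> : e * ((m * b1 + n * b2)%N%:Z * (a1 * q + a2)%N%:Z
             - (m * a1 + n * a2)%N%:Z * (b1 * q + b2)%N%:Z) = m%:Z - n%:Z * q%:Z.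
  by rewrite [in RHS]E1 [in RHS]E2 !PoszD !PoszM; ring.
rewrite subr_ge0 -PoszM lez_nat mulnC qm /= divr_ge0 ?ler0n//=.
rewrite ler_pdivrMr ?ltr0n// mul1r ler_nat.
(* The fraction is at most 1 as a combination of [a1/b1] and the endpoint mediant; comparing [a2]
   with [b2] would fail for the pair 0/1, 1/0. *)
have -> : (m = (m - q * n) + q * n)%N by rewrite subnK.
have : ((m - q * n) * a1 <= (m - q * n) * b1)%N by rewrite leq_mul2l ab1 orbT.
have : (n * (a1 * q + a2) <= n * (b1 * q + b2))%N by rewrite leq_mul2l abq orbT.
lia.
Qed.

End Mediants.

(** * Positions in the Farey sequence and its symmetry *)

Lemma le_frac_numq (x : rat) (a b : nat) : (0 < b)%N ->
  (x <= a%:R / b%:R) = (numq x * b%:Z <= a%:Z * denq x).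
Proof.
move=> b0; rewrite ler_pdivlMr ?ltr0n// -{1}(divq_num_den x) mulrAC.
by rewrite ler_pdivrMr ?ltr0z// !pmulrn -!intrM ler_int.
Qed.

Lemma ge_frac_numq (x : rat) (a b : nat) : (0 < b)%N ->
  (a%:R / b%:R <= x) = (a%:Z * denq x <= numq x * b%:Z).
Proof.
move=> b0; rewrite ler_pdivrMr ?ltr0n// -{1}(divq_num_den x) mulrAC.
by rewrite ler_pdivlMr ?ltr0z// !pmulrn -!intrM ler_int.
Qed.

Lemma farey_posE (R : realType) (N a b : nat) :
  farey_pos N (a%:R / b%:R : R) = count (<= (a%:R / b%:R : rat)) (farey N).
Proof.
by apply: eq_count => x; rewrite -!(ratr_nat R) -fmorph_div ler_rat.
Qed.

Lemma count_le_split (s : seq rat) (u v : rat) : u <= v ->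
  count (<= v) s = (count (<= u)%R s + count (fun x => (u < x) && (x <= v))%R s)%N.
Proof.
move=> uv; elim: s => //= x s ->; rewrite addnACA; congr addn.
have [xu|ux] /= := leP x u; first by rewrite (le_trans xu uv).
by [].
Qed.

Lemma count_lt_split (s : seq rat) (u v : rat) : u <= v ->
  count (< v) s = (count (< u)%R s + count (fun x => (u <= x) && (x < v))%R s)%N.
Proof.
move=> uv; elim: s => //= x s ->; rewrite addnACA; congr addn.
have [ux|xu] /= := leP u x; first by [].
by rewrite (lt_le_trans xu uv).
Qed.

Lemma count_le_lt (s : seq rat) (u : rat) : uniq s ->
  count (<= u) s = (count (< u)%R s + (u \in s))%N.
Proof.
move=> us; rewrite -count_uniq_mem// -count_predUI.
rewrite [X in (_ + X)%N](_ : _ = 0%N) ?addn0.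
  by apply: eq_count => x /=; rewrite le_eqVlt orbC.
apply/eqP; rewrite -leqn0 leqNgt -has_count; apply/hasPn => x _ /=.
by case: eqP => [->|]; rewrite ?ltxx ?andbF.
Qed.

Lemma farey_sym (N : nat) : perm_eq (farey N) [seq 1 - x | x <- farey N].
Proof.
have inj : injective (fun x : rat => 1 - x) by move=> x y /addrI /oppr_inj.
apply: uniq_perm; rewrite ?map_inj_uniq ?farey_uniq// => x.
have -> : x = 1 - (1 - x) by rewrite subKr.
rewrite (mem_map inj) !mem_farey !subKr.
have -> : denq (1 - x) = denq x.
  rewrite -{1}(divq_num_den x).
  have -> : 1 - (numq x)%:~R / (denq x)%:~R
       = (denq x - numq x)%:~R / (denq x)%:~R :> rat.
    by rewrite intrB mulrBl divff// intr_eq0 denq_neq0.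
  have cop : coprimez (denq x - numq x) (denq x).
    rewrite coprimez_sym /coprimez gcdzDl -/(coprimez _ _) coprimezN coprimez_sym.
    by rewrite coprimezE coprime_num_den.
  by rewrite coprimeq_den// (negPf (denq_neq0 x)) gtr0_norm.
by congr (_ && _); apply/andP/andP => -[h1 h2]; split; lra.
Qed.

(** The reflection [x -> 1 - x] exchanges the elements below and above 1/2, so only 1/2 itself can
    unbalance the count. *)
Lemma farey_pos_half (R : realType) (N : nat) :
  `|(farey_pos N (2^-1 : R))%:R - (size (farey N))%:R / 2| <= 1 :> R.
Proof.
have := farey_posE R N 1 2; rewrite !mul1r => ->.
have E1 := count_le_lt (2^-1) (farey_uniq N).
have E2 : count (< (2^-1 : rat)) (farey N)
    = count (predC (<= (2^-1 : rat))) (farey N).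
  rewrite (permP (farey_sym N)) count_map; apply: eq_count => x /=.
  by rewrite -ltNge; apply/idP/idP => h; lra.
rewrite -(count_predC (<= (2^-1 : rat)) (farey N)) natrD -E2 E1 natrD.
by case: (_ \in _); rewrite /= ?mulr1n ?mulr0n ler_norml; lra.
Qed.

(** * Sums of the totient function *)

Lemma delta_gt0 (R : realType) (A x : R) : 0 < delta A x.
Proof. exact: expR_gt0. Qed.

Lemma delta_le1 (R : realType) (A x : R) : 0 <= A -> delta A x <= 1.
Proof.
move=> A0; rewrite /delta -[leRHS]expR0 ler_expR oppr_le0.
by rewrite mulr_ge0// divr_ge0// powR_ge0.
Qed.

(** Keeps [ln (ln x)] away from 0 for [x >= 3]. From [exp (-1/6) >= 5/6] one gets
    [e <= (6/5)^6 < 3]. *)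
Lemma ln3_gt1 (R : realType) : 1 < ln (3 : R).
Proof.
rewrite -ltr_expR lnK ?posrE//.
have h : 5 / 6 <= expR (- (1 / 6)) :> R.
  by apply: le_trans (expR_ge1Dx _); lra.
have -> : expR 1 = (expR (- (1 / 6)))^-1 ^+ 6 :> R.
  by rewrite -expRN opprK -expRM_natl; congr expR; lra.
rewrite exprVn invf_plt ?posrE ?exprn_gt0 ?expR_gt0//.
have h6 : (5 / 6) ^+ 6 <= expR (- (1 / 6)) ^+ 6 :> R.
  by rewrite lerXn2r// nnegrE// expR_ge0.
by apply: lt_le_trans h6; lra.
Qed.

(** Beyond the point [Y] with [Y^(1 - r) = 2 B] the power is dominated by [y / 2]; before it, by its
    value at [Y]. *)
Lemma powR_sublinear (R : realType) (B r : R) : 0 < r -> r < 1 -> 0 <= B ->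
  exists M : R, forall y : R, 0 <= y -> B * y `^ r <= y / 2 + M.
Proof.
move=> r0 r1 B0; pose Y := (2 * B) `^ (1 - r)^-1.
exists (B * Y `^ r) => y y0.
have [yY|Yy] := leP y Y.
  have : B * y `^ r <= B * Y `^ r.
    by rewrite ler_wpM2l// ge0_ler_powR// ?nnegrE ?powR_ge0// ltW.
  lra.
have h : 2 * B <= y `^ (1 - r).
  have -> : 2 * B = Y `^ (1 - r).
    by rewrite /Y -powRrM mulVf ?powRr1 ?mulr_ge0// subr_eq0 gt_eqF.
  by rewrite ge0_ler_powR// ?nnegrE ?subr_ge0 ?(ltW r1) ?powR_ge0 ?ltW.
have yE : y = y `^ (1 - r) * y `^ r.
  by rewrite -powRD ?subrK ?powRr1// oner_eq0.
have : 2 * B * y `^ r <= y by rewrite {2}yE ler_wpM2r// powR_ge0.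
have : 0 <= B * Y `^ r by rewrite mulr_ge0// powR_ge0.
lra.
Qed.

(** With [y = ln x], the exponent in [delta] is at most [A / k * y^0.6 <= y / 2 + M] in absolute
    value, and [exp (- y / 2) = 1 / sqrt x]. *)
Lemma delta_ge_rsqrt (R : realType) (A : R) : 0 <= A ->
  exists2 C : R, 0 < C &
    forall x : R, 3 <= x -> (Num.sqrt x)^-1 <= C * delta A x.
Proof.
move=> A0; set k := ln (ln (3 : R)) `^ (2 / 10).
have k0 : 0 < k by rewrite powR_gt0// ln_gt0// ln3_gt1.
have [M HM] : exists M : R, forall y, 0 <= y -> A / k * y `^ (6 / 10) <= y / 2 + M.
  by apply: powR_sublinear; rewrite ?divr_ge0 ?(ltW k0)//; lra.
exists (expR M); first exact: expR_gt0.
move=> x x3; have x0 : 0 < x by lra.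
have y1 : ln 3 <= ln x by rewrite ler_ln// posrE.
have l3 := ln3_gt1 R.
have yk : k <= ln (ln x) `^ (2 / 10).
  have h : ln (ln (3 : R)) <= ln (ln x) by rewrite ler_ln// posrE; lra.
  have h0 := ln_gt0 l3.
  by apply: ge0_ler_powR => //; rewrite nnegrE; lra.
rewrite /delta -expRD.
have -> : (Num.sqrt x)^-1 = expR (- (ln x / 2)).
  rewrite expRN; congr (_^-1); apply/eqP.
  rewrite -(eqrXn2 (ltn0Sn 1)) ?sqrtr_ge0 ?expR_ge0// sqr_sqrtr ?ltW//.
  by rewrite -expRM_natl mulrC divfK// lnK ?posrE.
rewrite ler_expR.
have := HM (ln x) (ltW (lt_le_trans (lt_trans ltr01 l3) y1)).
suff : A * (ln x `^ (6 / 10) / ln (ln x) `^ (2 / 10)) <= A / k * ln x `^ (6 / 10) by lra.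
rewrite -mulrA ler_wpM2l// mulrC ler_wpM2r ?powR_ge0// lef_pV2 ?posrE//.
exact: lt_le_trans yk.
Qed.

(* Comparing [S n] with the means of [S] over the windows of length about
   [sqrt n] on both sides of [n]. *)
Lemma monotone_linear_of_sum_quadratic (R : realType) (S : nat -> R) (c C : R) :
  0 <= c -> 0 <= C -> {homo S : m n / (m <= n)%N >-> m <= n} ->
  (forall n, `|c * n%:R ^+ 2 - \sum_(0 <= k < n) S k| <= C * n%:R) ->
  forall n, (0 < n)%N -> `|S n - 2 * c * n%:R| <= (c + 9 * C) * Num.sqrt n%:R.
Proof.
move=> c0 C0 Smono HD n n0; pose h := Num.truncn (Num.sqrt n%:R : R).
have s1 : 1 <= Num.sqrt n%:R :> R by rewrite -[leLHS]sqrtr1 ler_wsqrtr// ler1n.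
have /andP[hs sh] := truncn_itv (le_trans ler01 s1).
rewrite -/h in hs sh.
have h0 : (0 < h)%N by rewrite -(ltr_nat R); rewrite -natr1 in sh; lra.
have h1 : 1 <= h%:R :> R by rewrite ler1n.
have sqs : Num.sqrt n%:R ^+ 2 = n%:R :> R by rewrite sqr_sqrtr.
(* Because [sqrt n < h + 1 <= 2 h]. *)
have nh : n%:R <= 4 * h%:R ^+ 2 :> R.
  by rewrite -natr1 in sh; rewrite -sqs; nra.
have hn : (h <= n)%N by rewrite -(ler_nat R) -sqs; nra.
have up : h%:R * S n <= \sum_(n <= k < n + h) S k.
  rewrite mulr_natl -[X in _ *+ X](addKn n h) -sumr_const_nat.
  by apply: ler_sum_nat => k /andP[nk _]; exact: Smono.
have lo : \sum_(n - h <= k < n) S k <= h%:R * S n.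
  rewrite mulr_natl -[X in _ *+ X](subKn hn) -sumr_const_nat.
  by apply: ler_sum_nat => k /andP[_ kn]; exact/Smono/ltnW.
have := HD (n + h)%N; rewrite (@big_cat_nat _ _ _ n) ?leq_addr//= => /ler_normlP[D2 _].
have := HD n; rewrite {1}(@big_cat_nat _ _ _ (n - h)) ?leq_subr//= => /ler_normlP[_ D4].
have := HD n => /ler_normlP[_ E4].
have := HD (n - h)%N => /ler_normlP[D5 _].
rewrite natrB// in D5; rewrite natrD in D2.
have hh : 0 < h%:R :> R by lra.
(* After multiplication by [h], the quadratic leaves an excess [c h^2], and the errors at the two
   ends of a window total at most [C (2 n + h) <= 9 C h^2]. *)
have : `|S n - 2 * c * n%:R| <= (c + 9 * C) * h%:R.
  have Cn : C * n%:R <= C * (4 * h%:R ^+ 2) by rewrite ler_wpM2l.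
  have Ch : C * h%:R <= C * h%:R ^+ 2 by rewrite ler_wpM2l//; nra.
  have Ch0 : 0 <= C * h%:R ^+ 2 by rewrite mulr_ge0// sqr_ge0.
  have Ch1 : 0 <= C * h%:R by rewrite mulr_ge0// ltW.
  apply/ler_normlP; split; rewrite -(ler_pM2l hh); lra.
move=> H; apply: le_trans H _; rewrite ler_wpM2l//; lra.
Qed.

(** * The Walfisz estimate at integers *)

Definition totient_ratio_sum (R : realType) (n : nat) : R :=
  \sum_(1 <= k < n.+1) (totient k)%:R / k%:R.

Definition totient_sum (R : realType) (n : nat) : R :=
  \sum_(1 <= k < n.+1) (totient k)%:R.

Lemma totient_ratio_sumS (R : realType) (n : nat) :
  totient_ratio_sum R n.+1
  = totient_ratio_sum R n + (totient n.+1)%:R / n.+1%:R.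
Proof. by rewrite /totient_ratio_sum big_nat_recr. Qed.

Lemma totient_ratio_sum_mono (R : realType) :
  {homo @totient_ratio_sum R : m n / (m <= n)%N >-> m <= n}.
Proof.
apply: homo_leq => [x|y x z|n]; [exact: lexx|exact: le_trans|].
by rewrite totient_ratio_sumS lerDl divr_ge0.
Qed.

(** Summation by parts, using [k * (phi(k) / k) = phi(k)]. *)
Lemma sum_totient_ratio_sum (R : realType) (n : nat) :
  \sum_(0 <= k < n) totient_ratio_sum R k
  = n%:R * totient_ratio_sum R n - totient_sum R n.
Proof.
elim: n => [|n IH].
  by rewrite big_nil mul0r /totient_sum big_nil subr0.
rewrite big_nat_recr//= IH totient_ratio_sumS /totient_sum [in RHS]big_nat_recr//=.
rewrite mulrDr [_ * (_ / _)]mulrC divfK ?pnatr_eq0// -[in RHS]natr1; ring.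
Qed.

Lemma totient_errE (R : realType) (n : nat) :
  totient_err n%:R = totient_sum R n - 3 / pi ^+ 2 * n%:R ^+ 2.
Proof. by rewrite /totient_err natrK. Qed.

Lemma totient_ratio_errE (R : realType) (n : nat) :
  totient_ratio_err n%:R = totient_ratio_sum R n - 6 / pi ^+ 2 * n%:R.
Proof. by rewrite /totient_ratio_err natrK. Qed.

Lemma walfisz_differenceE (R : realType) (n : nat) :
  totient_err (n%:R : R) - n%:R * totient_ratio_err n%:R
  = 3 / pi ^+ 2 * n%:R ^+ 2 - \sum_(0 <= k < n) totient_ratio_sum R k.
Proof.
rewrite totient_errE totient_ratio_errE sum_totient_ratio_sum.
by rewrite -[6 : R]/(6%:R) -[6%N]/(2 * 3)%N natrM; ring.
Qed.

Lemma walfisz_estimate_ge0 (R : realType) (A : R) : walfisz_estimate A ->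
  exists2 C : R, 0 <= C & forall x : R, 3 <= x ->
    `|totient_err x - x * totient_ratio_err x| <= C * (x * delta A x).
Proof.
move=> [C HC]; exists C => //.
(* At 3 the estimate bounds a norm by [C] times a positive number. *)
have := le_trans (normr_ge0 _) (HC 3 (lexx _)).
by rewrite pmulr_lge0// mulr_gt0// delta_gt0.
Qed.

Lemma totient_ratio_err_bound (R : realType) (A : R) :
  0 <= A -> walfisz_estimate A ->
  exists2 K : R, 0 <= K & forall n, (0 < n)%N ->
    `|totient_ratio_err (n%:R : R)| <= K * Num.sqrt n%:R.
Proof.
move=> A0 /walfisz_estimate_ge0[C C0 HC].
pose T n : R := totient_err n%:R - n%:R * totient_ratio_err n%:R.
(* The values at 1 and 2, below the range of the hypothesis, are absorbed in the constant; at 0 the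
   difference vanishes. *)
pose C' := C + `|T 1%N| + `|T 2%N|.
have C'0 : 0 <= C' by rewrite !addr_ge0.
have c0 : 0 <= 3 / pi ^+ 2 :> R by rewrite divr_ge0// sqr_ge0.
exists (3 / pi ^+ 2 + 9 * C'); first by rewrite addr_ge0// mulr_ge0.
move=> n n0.
have HT k : `|3 / pi ^+ 2 * k%:R ^+ 2 - \sum_(0 <= j < k) totient_ratio_sum R j|
    <= C' * k%:R.
  rewrite -walfisz_differenceE -/(T k); have := normr_ge0 (T 1%N).
  have := normr_ge0 (T 2%N).
  case: k => [|[|[|k]]] t2 t1.
  - by rewrite /T walfisz_differenceE big_geq// mulr0n expr0n !mulr0 subrr normr0.
  - by rewrite /C' mulr1; lra.
  - by rewrite /C'; lra.
  have k3 : 3 <= k.+3%:R :> R by rewrite ler_nat.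
  apply: le_trans (HC _ k3) _; apply: ler_pM => //.
  - by rewrite mulr_ge0// ltW// delta_gt0.
  - by rewrite /C'; lra.
  - by rewrite ler_piMr// delta_le1.
have := monotone_linear_of_sum_quadratic c0 C'0 (@totient_ratio_sum_mono R) HT n0.
rewrite totient_ratio_errE.
by congr (`|_ - _| <= _); rewrite mulrA -natrM.
Qed.

(** * The asymptotic estimate *)

(** Exact for [e = 1]. For [e = -1] the counted interval is closed at the mediant and open at
    [a1/b1], the reverse of what positions count, so membership of the endpoints shifts the result
    by at most 1. *)
Lemma farey_pos_mediant (R : realType) (a1 b1 a2 b2 q L i : nat) (e : int) :
  e = a2%:Z * b1%:Z - a1%:Z * b2%:Z -> (e = 1 \/ e = -1) ->
  (0 < b1)%N -> (0 < q)%N -> (a1 <= b1)%N ->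
  (a1 * q + a2 <= b1 * q + b2)%N -> (L < i.+1 * q)%N ->
  `|(farey_pos (b1 * L) ((a1 * q + a2)%:R / (b1 * q + b2)%:R : R))%:R
    - ((farey_pos (b1 * L) (a1%:R / b1%:R : R))%:R
       + e%:~R * (\sum_(1 <= n < i.+1)
           count (fun m => coprime n m && (m * b1 + n * b2 <= b1 * L)%N)
             (index_iota (q * n) L.+1))%:R)| <= 1 :> R.
Proof.
move=> eE e1 b10 q0 ab1 abq Lq.
have e2 : e * e = 1 by case: e1 => ->.
rewrite -(count_farey_mediants eE e2 b10 q0 ab1 abq Lq) !farey_posE.
set A := (a1 * q + a2)%N; set B := (b1 * q + b2)%N.
have B0 : (0 < B)%N by rewrite addn_gt0 muln_gt0 b10 q0.
set u : rat := a1%:R / b1%:R; set v : rat := A%:R / B%:R.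
have eAB : e = A%:Z * b1%:Z - a1%:Z * B%:Z.
  by rewrite eE /A /B !PoszD !PoszM; ring.
have b10' : (0 : rat) < b1%:R by rewrite ltr0n.
have B0' : (0 : rat) < B%:R by rewrite ltr0n.
case: e1 => e1; rewrite e1.
  have uv : u <= v.
    rewrite ler_pdivlMr// mulrAC ler_pdivrMr// -!natrM ler_nat -lez_nat !PoszM; lia.
  rewrite (count_le_split _ uv) natrD mulr1z mul1r.
  rewrite [in X in _ - (_ + X)](eq_count (a2 := fun x => (u < x) && (x <= v))).
    by rewrite subrr normr0.
  move=> x; rewrite [u < x]ltNge !le_frac_numq// -ltNge !mul1r subr_gt0 subr_ge0.
  by rewrite [denq x * _]mulrC.
have vu : v <= u.
  rewrite ler_pdivlMr// mulrAC ler_pdivrMr// -!natrM ler_nat -lez_nat !PoszM; lia.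
rewrite !count_le_lt ?farey_uniq// (count_lt_split _ vu) !natrD.
rewrite mulrN1z mulN1r [in X in _ - (_ + X)](eq_count (a2 := fun x => (v <= x) && (x < u))); last first.
  move=> x; rewrite andbC ge_frac_numq// [x < u]ltNge ge_frac_numq// -ltNge.
  by rewrite !mulN1r !oppr_gt0 !oppr_ge0 subr_lt0 subr_le0 [denq x * _]mulrC.
by case: (u \in _); case: (v \in _); rewrite /= ?mulr1n ?mulr0n ler_norml; lra.
Qed.

(** As [n] divides [L], the slanted count applies with [k = L / n]; each of the [i] terms is off by
    at most [n <= i]. *)
Lemma lattice_count_estimate (R : realType) (b1 b2 q i n0 : nat) :
  (i < n0)%N -> (b2 < b1)%N -> (i * q <= lcm_upto n0)%N ->
  let L := lcm_upto n0 in
  `|(\sum_(1 <= n < i.+1)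
        count (fun m => coprime n m && (m * b1 + n * b2 <= b1 * L)%N)
          (index_iota (q * n) L.+1))%:R
    - (L%:R * totient_ratio_sum R i - q%:R * totient_sum R i)| <= i%:R ^+ 2.
Proof.
move=> ilt b21 iqL /=; set L := lcm_upto n0.
rewrite /totient_ratio_sum /totient_sum !mulr_sumr -sumrB natr_sum -sumrB.
apply: le_trans (ler_norm_sum _ _ _) _.
apply: (@le_trans _ _ (\sum_(1 <= n < i.+1) i%:R)); last first.
  by rewrite sumr_const_nat subn1/= -[i%:R *+ i]mulr_natl expr2.
apply: ler_sum_nat => n /andP[n1 ni]; rewrite ltnS in ni.
have /dvdnP[k Lk] : (n %| L)%N.
  by rewrite dvdn_lcm_upto// n1 (leq_trans ni)// ltnW.
have qk : (q <= k)%N.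
  rewrite -(leq_pmul2r n1) -Lk; apply: leq_trans iqL.
  by rewrite mulnC leq_mul2r ni orbT.
have := count_coprime_slanted n1 qk b21; rewrite -Lk /=.
move: (count _ _) => c [].
rewrite -!(ler_nat R) !natrD !natrM natrB// => c1 c2.
have -> : L%:R * ((totient n)%:R / n%:R) = k%:R * (totient n)%:R :> R.
  by rewrite Lk natrM mulrCA mulfK ?pnatr_eq0 -?lt0n// mulrC.
have : n%:R <= i%:R :> R by rewrite ler_nat.
rewrite ler_norml; lra.
Qed.

(** The summand [2 i^2] reserves room for the lattice count error [i^2] and for bounded errors. *)
Lemma lcm_upto_main_term (R : realType) (A : R) : 0 <= A -> walfisz_estimate A ->
  exists2 M : R, 0 <= M & forall n i q : nat,
    (3 <= i)%N -> (i < n)%N ->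
    (i * q <= lcm_upto n)%N -> (lcm_upto n < i.+1 * q)%N ->
    let L : R := (lcm_upto n)%:R in
    `|L * totient_ratio_sum R i - q%:R * totient_sum R i
      - 3 / pi ^+ 2 * (q%:R * (L ^+ 2 / q%:R ^+ 2 - frac_part (L / q%:R) ^+ 2))|
      + 2 * i%:R ^+ 2 <= M * (L * delta A i%:R).
Proof.
move=> A0 hA.
have [K K0 HK] := totient_ratio_err_bound A0 hA.
have [C C0 HC] := walfisz_estimate_ge0 hA.
have [D D0 HD] := delta_ge_rsqrt A0.
(* [K * D] serves [(L - i q) H], [C] serves [q (E - i H)], and [8 * D] serves [2 i^2]. *)
exists (K * D + C + 8 * D); first by rewrite !addr_ge0 ?mulr_ge0// ltW.
move=> n i q i3 ilt iqL Lq /=; set L : R := (lcm_upto n)%:R.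
have i0 : (0 < i)%N by lia.
have q0 : (0 < q)%N by rewrite lt0n; apply/eqP => q0; rewrite q0 muln0 in Lq.
have x3 : 3 <= i%:R :> R by rewrite ler_nat.
have qR : 0 < q%:R :> R by rewrite ltr0n.
have qL : i%:R * q%:R <= L by rewrite -natrM ler_nat.
have Lq' : L < (i%:R + 1) * q%:R by rewrite natr1 -natrM ltr_nat.
have cube : i%:R ^+ 3 <= 4 * L.
  by rewrite -natrX -natrM ler_nat cube_le_lcm_upto// ilt andbT; lia.
have flo : (Num.floor (L / q%:R))%:~R = i%:R :> R.
  suff -> : Num.floor (L / q%:R) = i%:Z by [].
  by apply/floor_def; rewrite intrD -!pmulrn ler_pdivlMr// ltr_pdivrMr// qL.
(* The fractional part is [L / q - i], so the squares of [L / q] cancel. *)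
have mainE : q%:R * (L ^+ 2 / q%:R ^+ 2 - frac_part (L / q%:R) ^+ 2)
    = 2 * i%:R * L - i%:R ^+ 2 * q%:R.
  by rewrite /frac_part flo; field; rewrite gt_eqF.
have HKi := HK i i0; have HCi := HC _ x3; have HDi := HD _ x3.
move: HKi HCi; set H := totient_ratio_err _; set E := totient_err _ => HKi HCi.
have SE : totient_ratio_sum R i = H + 2 * (3 / pi ^+ 2) * i%:R.
  rewrite /H totient_ratio_errE; lra.
have PE : totient_sum R i = E + 3 / pi ^+ 2 * i%:R ^+ 2.
  rewrite /E totient_errE; lra.
have -> : L * totient_ratio_sum R i - q%:R * totient_sum R i
    - 3 / pi ^+ 2 * (q%:R * (L ^+ 2 / q%:R ^+ 2 - frac_part (L / q%:R) ^+ 2))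
    = (L - i%:R * q%:R) * H - q%:R * (E - i%:R * H).
  by rewrite mainE SE PE; ring.
set s := Num.sqrt i%:R in HKi HDi *.
have ss : s ^+ 2 = i%:R by rewrite sqr_sqrtr.
have s0 : 0 < s by rewrite sqrtr_gt0; lra.
have s1 : 1 <= s by nra.
set d := delta A i%:R in HCi HDi *.
have d0 : 0 < d by exact: delta_gt0.
have L0 : 0 < L by apply: lt_le_trans qL; rewrite mulr_gt0//; lra.
have Ld : L / s <= D * (L * d).
  by rewrite mulrCA ler_pM2l.
(* Here [0 <= L - i q <= q] and [q sqrt i = i q / sqrt i <= L / sqrt i]. *)
have t1 : `|(L - i%:R * q%:R) * H| <= K * (D * (L * d)).
  rewrite normrM (@ger0_norm _ (L - _)) ?subr_ge0//.
  apply: (@le_trans _ _ (q%:R * (K * s))).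
    by apply: ler_pM; rewrite ?subr_ge0// lerBlDl; lra.
  rewrite mulrCA ler_wpM2l//; apply: le_trans Ld.
  by rewrite ler_pdivlMr// -mulrA -expr2 ss mulrC.
have t2 : `|q%:R * (E - i%:R * H)| <= C * (L * d).
  rewrite normrM (@ger0_norm _ q%:R) ?(ltW qR)//.
  apply: (@le_trans _ _ (q%:R * (C * (i%:R * d)))); first by rewrite ler_pM2l.
  by rewrite mulrCA ler_wpM2l// mulrA ler_wpM2r ?(ltW d0)// mulrC.
(* Here [i^2 sqrt i <= i^3 <= 4 L]. *)
have t3 : i%:R ^+ 2 <= 4 * (D * (L * d)).
  apply: (@le_trans _ _ (4 * (L / s))); last by rewrite ler_pM2l.
  rewrite mulrA ler_pdivlMr//; apply: le_trans cube.
  rewrite [leRHS]exprSr ler_wpM2l ?sqr_ge0//; nra.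
have := ler_normB ((L - i%:R * q%:R) * H) (q%:R * (E - i%:R * H)).
lra.
Qed.

(** The [+ 1] on the left is slack with which the special cases replace [I_N(0)] by 0 and [I_N(1/2)]
    by [|F_N| / 2]. *)
Lemma farey_pos_mediant_estimate (R : realType) (A : R) :
  0 <= A -> walfisz_estimate A ->
  exists2 M : R, 0 <= M & forall (a1 b1 a2 b2 n i q : nat) (e : int),
    e = a2%:Z * b1%:Z - a1%:Z * b2%:Z -> (e = 1 \/ e = -1) ->
    (b2 < b1)%N -> (a1 <= b1)%N -> (a1 * q + a2 <= b1 * q + b2)%N ->
    (3 <= i)%N -> (i < n)%N ->
    (i * q <= lcm_upto n)%N -> (lcm_upto n < i.+1 * q)%N ->
    let N := (b1 * lcm_upto n)%N in
    `|(farey_pos N ((a1 * q + a2)%:R / (b1 * q + b2)%:R : R))%:R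
      - ((farey_pos N (a1%:R / b1%:R : R))%:R
         + e%:~R * (3 / pi ^+ 2) * q%:R
           * (N%:R ^+ 2 / (b1%:R ^+ 2 * q%:R ^+ 2)
              - frac_part (N%:R / (b1%:R * q%:R)) ^+ 2))| + 1
    <= M * (N%:R * delta A i%:R).
Proof.
move=> A0 hA; have [M M0 HM] := lcm_upto_main_term A0 hA.
exists M => // a1 b1 a2 b2 n i q e eE e1 b21 ab1 abq i3 ilt iqL Lq /=.
set N := (b1 * lcm_upto n)%N.
have q0 : (0 < q)%N by rewrite lt0n; apply/eqP => q0; rewrite q0 muln0 in Lq.
have b10 : (0 < b1)%N by lia.
have b1R : b1%:R != 0 :> R by rewrite pnatr_eq0 -lt0n.
have H1 := farey_pos_mediant R eE e1 b10 q0 ab1 abq Lq.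
have H2 := lattice_count_estimate R ilt b21 iqL.
have := HM n i q i3 ilt iqL Lq.
move: H1 H2; rewrite -/N /=; set L := lcm_upto n; set c := 3 / pi ^+ 2.
have -> : N%:R / (b1%:R * q%:R) = L%:R / q%:R :> R.
  by rewrite natrM -mulf_div divff ?mul1r.
have -> : N%:R ^+ 2 / (b1%:R ^+ 2 * q%:R ^+ 2) = L%:R ^+ 2 / q%:R ^+ 2 :> R.
  by rewrite natrM exprMn -mulf_div divff ?mul1r ?expf_neq0.
set X := (L%:R ^+ 2 / _ - _); set W := _ * totient_ratio_sum R i - _.
move: (\sum_(_ <= _ < _) _)%N => k; move: (farey_pos _ _)%:R (farey_pos _ _)%:R => p2 p1.
move=> H1 H2 H3.
have x3 : 3 <= i%:R :> R by rewrite ler_nat.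
have Ld : M * (L%:R * delta A i%:R) <= M * (N%:R * delta A i%:R).
  by rewrite ler_wpM2l// ler_pM2r ?delta_gt0// ler_nat /N leq_pmull.
apply: le_trans Ld; apply: le_trans H3.
(* One unit pays for the endpoints of the count, the other for the slack. *)
have i2 : 2 <= i%:R ^+ 2 :> R by nra.
have W1 := ler_norm (W - c * (q%:R * X)).
have W2 := ler_norm (- (W - c * (q%:R * X))); rewrite normrN in W2.
move: H1 H2 => /ler_normlP[H1 H1'] /ler_normlP[H2 H2'].
rewrite -lerBrDr; apply/ler_normlP.
by case: e1 H1 H1' => ->; rewrite ?mulr1z ?mulrN1z => H1 H1'; split; lra.
Qed.

Lemma farey_pos0_le1 (R : realType) (N : nat) :
  (farey_pos N (0%:R / 1%:R : R) <= 1)%N.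
Proof.
rewrite farey_posE mul0r count_le_lt ?farey_uniq//.
rewrite [count _ _](_ : _ = 0%N) ?leq_b1//.
apply/eqP; rewrite -leqn0 leqNgt -has_count; apply/hasPn => x.
by rewrite mem_farey => /andP[/andP[x0 _] _]; rewrite -leNgt.
Qed.

(** The factor [b] cancels: the range of [q] says that [i] is the integer part of [L / q]. *)
Lemma lcm_index_bounds (R : realType) (b L i q : nat) : (0 < b)%N -> (0 < i)%N ->
  (b * L)%:R / (b%:R * (i%:R + 1)) < q%:R :> R ->
  q%:R <= (b * L)%:R / (b%:R * i%:R) :> R ->
  (i * q <= L)%N /\ (L < i.+1 * q)%N.
Proof.
move=> b0 i0; rewrite natr1 -!natrM ltr_pdivrMr ?ltr0n ?muln_gt0 ?b0//.
rewrite ler_pdivlMr ?ltr0n ?muln_gt0 ?b0// -!natrM ltr_nat ler_nat.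
by rewrite ![(q * (b * _))%N]mulnCA ltn_pmul2l// leq_pmul2l// ![(q * _)%N]mulnC.
Qed.

(** Treats ordinary pairs and 0/1, 1/0 alike: the sign is the determinant [e], and [q >= 1] keeps
    the mediant at most 1. *)
Lemma farey_pair_sign (R : realType) (a1 b1 a2 b2 q : nat) :
  farey_pair a1 b1 a2 b2 -> (b2 < b1)%N -> (0 < q)%N ->
  let e := a2%:Z * b1%:Z - a1%:Z * b2%:Z in
  [/\ e = 1 \/ e = -1, (a1 <= b1)%N, (a1 * q + a2 <= b1 * q + b2)%N
    & farey_sign R a1 b1 a2 b2 = e%:~R].
Proof.
move=> + b21 q0 /=; case=> [[/and3P[b10 ab1 _] /and3P[b20 ab2 _]]|[-> -> -> ->]].
  rewrite distrC => e1.
  have e2 : a2%:Z * b1%:Z - a1%:Z * b2%:Z = 1 \/ a2%:Z * b1%:Z - a1%:Z * b2%:Z = -1.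
    by move: e1; move: (_ - _) => e; lia.
  split => //; first by apply: leq_add; rewrite ?leq_mul2r ?ab1 ?orbT.
  rewrite /farey_sign gtn_eqF//= ltr_pdivlMr ?ltr0n// mulrAC ltr_pdivrMr ?ltr0n//.
  rewrite -!natrM ltr_nat -ltz_nat !PoszM -subr_gt0.
  by case: e2 => ->.
by rewrite /farey_sign eqxx; split; [left| | lia|].
Qed.

Theorem corollary3p4 (R : realType) (A : R) (A_gt0 : 0 < A)
    (hA : walfisz_estimate A) :
  [/\ exists C : R,
        forall a1 b1 a2 b2 imax i N q : nat,
          farey_pair a1 b1 a2 b2 -> (b2 < b1)%N ->
          (3 <= i)%N -> (i < imax)%N ->
          N = (b1 * lcm_upto imax)%N ->
          N%:R / (b1%:R * (i%:R + 1)) < q%:R :> R ->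
          q%:R <= N%:R / (b1%:R * i%:R) :> R ->
          `| (farey_pos N ((a1 * q + a2)%:R / (b1 * q + b2)%:R : R))%:R
             - ((farey_pos N (a1%:R / b1%:R : R))%:R
                + farey_sign R a1 b1 a2 b2 * (3 / pi ^+ 2) * q%:R
                  * (N%:R ^+ 2 / (b1%:R ^+ 2 * q%:R ^+ 2)
                     - frac_part (N%:R / (b1%:R * q%:R)) ^+ 2)) |
          <= C * (N%:R * delta A i%:R),
      exists C : R,
        forall imax i N q : nat,
          (3 <= i)%N -> (i < imax)%N ->
          N = lcm_upto imax ->
          N%:R / (i%:R + 1) < q%:R :> R ->
          q%:R <= N%:R / i%:R :> R ->
          `| (farey_pos N (1 / q%:R : R))%:R
             - 3 / pi ^+ 2 * q%:R
               * (N%:R ^+ 2 / q%:R ^+ 2 - frac_part (N%:R / q%:R) ^+ 2) |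
          <= C * (N%:R * delta A i%:R)
    & exists C : R,
        forall imax i N q : nat,
          (3 <= i)%N -> (i < imax)%N ->
          N = (2 * lcm_upto imax)%N ->
          N%:R / (2 * (i%:R + 1)) < q%:R :> R ->
          q%:R <= N%:R / (2 * i%:R) :> R ->
          `| (farey_pos N ((q + 1)%:R / (2 * q + 1)%:R : R))%:R
             - ((size (farey N))%:R / 2
                + 3 / pi ^+ 2 * q%:R
                  * (N%:R ^+ 2 / (2 ^+ 2 * q%:R ^+ 2)
                     - frac_part (N%:R / (2 * q%:R)) ^+ 2)) |
          <= C * (N%:R * delta A i%:R)].
Proof.
have [M M0 HM] := farey_pos_mediant_estimate (ltW A_gt0) hA.
split; exists M.
- move=> a1 b1 a2 b2 imax i N q pair b21 i3 ilt -> q1 q2.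
  have [iqL Lq] := lcm_index_bounds (leq_ltn_trans (leq0n _) b21)
    (ltn_trans (isT : 0 < 2)%N i3) q1 q2.
  have q0 : (0 < q)%N by rewrite lt0n; apply/eqP => q0; rewrite q0 muln0 in Lq.
  have [e1 ab1 abq ->] := farey_pair_sign R pair b21 q0.
  have := HM _ _ _ _ _ _ _ _ erefl e1 b21 ab1 abq i3 ilt iqL Lq.
  by move=> /=; lra.
(* The pair 0/1, 1/0 has determinant 1; its base position lies between 0 and 1. *)
- move=> imax i N q i3 ilt -> q1 q2.
  have [||iqL Lq] := @lcm_index_bounds R 1 (lcm_upto imax) i q isT
    (ltn_trans (isT : 0 < 2)%N i3); rewrite ?mul1n ?mul1r//.
  have q0 : (0 < q)%N by rewrite lt0n; apply/eqP => q0; rewrite q0 muln0 in Lq.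
  have abq : (0 * q + 1 <= 1 * q + 0)%N by lia.
  have := HM 0%N 1%N 1%N 0%N _ _ _ 1 erefl (or_introl erefl) isT isT abq i3 ilt iqL Lq.
  rewrite /= mulr1z mul0n add0n !mul1n addn0 expr1n !mul1r.
  have := farey_pos0_le1 R (lcm_upto imax); rewrite -(ler_nat R).
  have := ler0n R (farey_pos (lcm_upto imax) (0%:R / 1%:R : R)).
  move: (farey_pos _ (0%:R / 1%:R))%:R => p p0 p1.
  rewrite -lerBrDr => /ler_normlP[h1 h2]; apply/ler_normlP; split; lra.
(* The pair 1/2, 1/1 has determinant 1; the symmetry of the sequence gives its base position. *)
- move=> imax i N q i3 ilt -> q1 q2.
  have [iqL Lq] := lcm_index_bounds (isT : 0 < 2)%N
    (ltn_trans (isT : 0 < 2)%N i3) q1 q2.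
  have abq : (1 * q + 1 <= 2 * q + 1)%N by lia.
  have := HM 1%N 2%N 1%N 1%N _ _ _ 1 erefl (or_introl erefl) isT isT abq i3 ilt iqL Lq.
  rewrite /= mul1n mulr1z !mul1r.
  have := farey_pos_half R (2 * lcm_upto imax).
  move: (farey_pos _ 2^-1)%:R => p /ler_normlP[p0 p1].
  rewrite -lerBrDr => /ler_normlP[h1 h2]; apply/ler_normlP; split; lra.
Qed.
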